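(* Let $M\ge 1$, $N\ge 2$, let $k_1,\dots,k_M>0$ be wave numbers, let $x_1,\dots,x_N$ be the imaging pixels with total path lengths $L_1,\dots,L_N$, and let $A=(e^{-jk_iL_n})_{1\le i\le M,\,1\le n\le N}$ be the sensing matrix. Assume that two point targets are located at arbitrary pixels $x_p$ and $x_q$ ($p\ne q$) of the imaging area, i.e. the exact solution $X^o\in\mathbb{C}^N$ has $p$-th and $q$-th entries equal to $1$ and all other entries equal to $0$. Let $b=AX^o$ and $\tilde X=A^*b$. Then the two reconstructed values $\tilde X_p$ and $\tilde X_q$ have the same magnitude, $|\tilde X_p|=|\tilde X_q|$, and, this common magnitude being assumed positive, they have opposite phases: if $\theta$ is the phase of $\tilde X_p$, then $-\theta$ is the phase of $\tilde X_q$ (modulo $2\pi$).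
   Context: Setting: a noiseless linear imaging system $AX=b$ with a single transmitter $T_x$, a single receiver $R_x$, and $M$ frequencies with wave numbers $k_1,\dots,k_M>0$. The imaging area has $N$ pixels located at points $x_1,\dots,x_N$ of Euclidean space, and $L_n=|T_x-x_n|+|x_n-R_x|$ is the total path length from the transmitter to $x_n$ and then to the receiver. Here $j$ is the imaginary unit. The sensing matrix $A$ is the $M\times N$ complex matrix with $(i,n)$ entry $e^{-jk_iL_n}$, and $A^*$ is its conjugate transpose. The data are generated synthetically (''inverse crime'') by $b=AX^o$, where $X^o\in\mathbb{C}^N$ is the exact reflectivity vector (interference between the targets is neglected), and the reconstructed solution is $\tilde X=A^*b$. The reconstructed values of the point targets at pixels $x_p,x_q$ are the entries $\tilde X_p,\tilde X_q$. Magnitude and phase of a nonzero complex number $z=Ce^{j\theta}$ are $C=|z|>0$ and $\theta$, the phase being considered modulo $2\pi$ (wrapped phase, so $\pi$ and $-\pi$ are the same). *)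

(* Defs.v *)
From HB Require Import structures.
From mathcomp Require Import all_boot all_order all_algebra.
From mathcomp Require Import complex.
From mathcomp Require Import reals topology normedtype sequences exp trigo.

Set Implicit Arguments.
Unset Strict Implicit.
Unset Printing Implicit Defensive.

Import Order.TTheory GRing.Theory Num.Theory.
Local Open Scope ring_scope.
Local Open Scope complex_scope.

(* The analysis library's norm on 'rV[R]_d is the sup norm, hence this
   explicit Euclidean one. *)
Definition enorm (R : realType) (d : nat) (v : 'rV[R]_d) : R :=
  Num.sqrt (\sum_(c < d) v 0 c ^+ 2).

Definition path_length (R : realType) (d : nat) (Tx Rx x : 'rV[R]_d) : R :=
  enorm (Tx - x) + enorm (x - Rx).

(* Complex exponential, e^{a + jb} = e^a (cos b + j sin b); 'i is j. *)
Definition cexp (R : realType) (z : R[i]) : R[i] :=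
  let: a +i* b := z in (expR a)%:C * (cos b +i* sin b).

Definition sensing_matrix (R : realType) (M N : nat)
    (k : 'I_M -> R) (L : 'I_N -> R) : 'M[R[i]]_(M, N) :=
  \matrix_(i < M, n < N) cexp (- ('i * (k i)%:C * (L n)%:C)).

Definition conj_transpose (R : realType) (m n : nat) (A : 'M[R[i]]_(m, n)) :
    'M[R[i]]_(n, m) :=
  (map_mx (fun z : R[i] => z^*) A)^T.

(* [t] is a phase of the nonzero number [z]. By periodicity this is a condition
   on [t] modulo 2 pi only, so it needs no choice of a principal value. *)
Definition has_phase (R : realType) (z : R[i]) (t : R) : Prop :=
  z != 0 /\ z = `|z| * cexp ('i * t%:C).

(* Main.v *)
(* The entries of [A] have modulus 1, so [Xt p] is the sum over the frequencies
   [i] of [1 + (A i p)^* * A i q]; exchanging [p] and [q] conjugates each summand,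
   hence [Xt q = (Xt p)^*]. *)

Require Import Defs.
From HB Require Import structures.
From mathcomp Require Import all_boot all_order all_algebra.
From mathcomp Require Import complex.
From mathcomp Require Import reals exp trigo.

Set Implicit Arguments.
Unset Strict Implicit.
Unset Printing Implicit Defensive.

Import Order.TTheory GRing.Theory Num.Theory.
Local Open Scope ring_scope.
Local Open Scope complex_scope.

(** The two reconstructed values are complex conjugates, and conjugation keeps the modulus and
    negates the phase ([has_phase_conj]). The conjugacy rests on [mulmx_two_targets], which gives
    the data as sums of two columns of [A], and on [sensing_matrix_unimodular], which turns the
    diagonal terms into 1. *)

Lemma cexp_imaginary (R : realType) (t : R) :
  cexp ('i * t%:C) = cos t +i* sin t.
Proof.
have -> : 'i * t%:C = 0 +i* t :> R[i] by simpc.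
by rewrite /cexp expR0 mul1r.
Qed.

Lemma conj_cexp_imaginary (R : realType) (t : R) :
  (cexp ('i * t%:C))^* = cexp ('i * (- t)%:C).
Proof. by rewrite !cexp_imaginary cosN sinN. Qed.

Lemma cexp_imaginary_unimodular (R : realType) (t : R) :
  (cexp ('i * t%:C))^* * cexp ('i * t%:C) = 1.
Proof.
rewrite cexp_imaginary; apply/eqP; rewrite eq_complex /=.
by rewrite mulNr opprK -!expr2 cos2Dsin2 mulNr [sin t * _]mulrC subrr !eqxx.
Qed.

(** Conjugating the polar form fixes the modulus, which is real, and inverts the unimodular
    factor. *)
Lemma has_phase_conj (R : realType) (z : R[i]) (t : R) :
  has_phase z t -> has_phase z^* (- t).
Proof.
case=> z0 zE; split; first by rewrite conjc_eq0.
have normzJ : (`|z|)^* = `|z| by rewrite normc_def conjc_real.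
by rewrite normcJ -conj_cexp_imaginary -[in RHS]normzJ -rmorphM -zE.
Qed.

(** The exponent is ['i] times the real number [- (k i * L n)], so each entry lies on the unit
    circle. *)
Lemma sensing_matrix_unimodular (R : realType) (M N : nat)
    (k : 'I_M -> R) (L : 'I_N -> R) (i : 'I_M) (n : 'I_N) :
  (sensing_matrix k L i n)^* * sensing_matrix k L i n = 1.
Proof.
rewrite mxE.
have -> : - ('i * (k i)%:C * (L n)%:C) = 'i * (- (k i * L n))%:C :> R[i].
  by rewrite -mulrA -mulrN rmorphN rmorphM.
exact: cexp_imaginary_unimodular.
Qed.

Lemma mulmx_two_targets (S : pzSemiRingType) (M N : nat) (A : 'M[S]_(M, N))
    (p q : 'I_N) (X : 'cV[S]_N) (i : 'I_M) :
  p != q -> X p 0 = 1 -> X q 0 = 1 ->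
  (forall n : 'I_N, n != p -> n != q -> X n 0 = 0) ->
  (A *m X) i 0 = A i p + A i q.
Proof.
move=> pq Xp Xq X0; rewrite mxE (bigD1 p) //= (bigD1 q) 1?eq_sym //= Xp Xq !mulr1.
by rewrite big1 ?addr0 // => n /andP[np nq]; rewrite X0 // mulr0.
Qed.

Theorem theorem2 (R : realType) (d M N : nat) (hM : (1 <= M)%N) (hN : (2 <= N)%N)
    (k : 'I_M -> R) (hk : forall i : 'I_M, 0 < k i)
    (Tx Rx : 'rV[R]_d) (x : 'I_N -> 'rV[R]_d)
    (L : 'I_N -> R) (hL : forall n : 'I_N, L n = path_length Tx Rx (x n))
    (A : 'M[R[i]]_(M, N)) (hA : A = sensing_matrix k L)
    (p q : 'I_N) (hpq : p != q)
    (Xo : 'cV[R[i]]_N) (hp : Xo p 0 = 1) (hq : Xo q 0 = 1)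
    (h0 : forall n : 'I_N, n != p -> n != q -> Xo n 0 = 0)
    (b : 'cV[R[i]]_M) (hb : b = A *m Xo)
    (Xt : 'cV[R[i]]_N) (hXt : Xt = conj_transpose A *m b) :
  `|Xt p 0| = `|Xt q 0| /\
  (0 < `|Xt p 0| ->
   forall theta : R, has_phase (Xt p 0) theta -> has_phase (Xt q 0) (- theta)).
Proof.
have XtE n : Xt n 0 = \sum_i (A i n)^* * (A i p + A i q).
  rewrite hXt hb mxE; apply: eq_bigr => i _.
  by rewrite (mulmx_two_targets A i hpq hp hq h0) !mxE.
have unimod i n : (A i n)^* * A i n = 1.
  by rewrite hA sensing_matrix_unimodular.
have XtqE : Xt q 0 = (Xt p 0)^*.
  rewrite !XtE rmorph_sum; apply: eq_bigr => i _.
  (* For each frequency, both sides reduce to [1 + (A i q)^* * A i p]. *)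
  by rewrite /= rmorphM rmorphD /= conjcK !mulrDr ![A i p * _]mulrC !unimod addrC.
by rewrite XtqE; split=> [|_ theta]; [rewrite normcJ | exact: has_phase_conj].
Qed.
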